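(* Let $A$ be a simple unital $C^*$-algebra with at most one tracial state, and suppose $A$ contains a non-trivial projection. Let $L$ be a closed subspace of $A$. Then the following are equivalent: (1) $L$ is a Lie ideal of $A$; (2) $s^{-1}Ls\subseteq L$ for all invertible elements $s\in A$; (3) $u^*Lu\subseteq L$ for all unitaries $u\in A$.
   Context: For elements $x,y$ of a complex associative algebra $A$, $[x,y]:=xy-yx$. A subspace $L$ of $A$ is a Lie ideal if $[a,x]\in L$ for all $a\in A$, $x\in L$. A tracial state on a $C^*$-algebra $A$ is a positive linear functional $\varphi$ of norm one with $\varphi(ab)=\varphi(ba)$ for all $a,b\in A$. A projection is non-trivial if it is different from $0$ and $1$. *)

(* Defs.v *)
From HB Require Import structures.
From mathcomp Require Import all_boot all_order all_algebra.
From mathcomp Require Import complex.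
From mathcomp Require Import all_classical all_reals all_analysis.

Set Implicit Arguments.
Unset Strict Implicit.
Unset Printing Implicit Defensive.

Import Order.TTheory GRing.Theory Num.Theory.
Import ComplexField.Normc.

Local Open Scope classical_set_scope.
Local Open Scope ring_scope.

(* Num.NormedZmodule and GRing.UnitRing are already joined in Num.NumDomain,
   where the norm takes its values in the ring itself, so HB rejects another
   structure on both: the norm is a field here. Uniformity, topology and
   completeness are those of the library, with the uniformity tied to the norm
   by [entourage_cnorm].
   The inverse of unitAlgType is no extra data: its unit predicate is two-sided
   invertibility and [^-1] is the identity off the units. *)
HB.mixin Record isCStarAlgebra (R : realType) A
    of Uniform A & GRing.UnitAlgebra R[i] A := {
  cnorm : A -> R;
  star : A -> A;
  cnorm0_eq0 : forall x : A, cnorm x = 0 -> x = 0;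
  cnormD : forall x y : A, cnorm (x + y) <= cnorm x + cnorm y;
  cnormZ : forall (c : R[i]) (x : A), cnorm (c *: x) = normc c * cnorm x;
  cnormM : forall x y : A, cnorm (x * y) <= cnorm x * cnorm y;
  entourage_cnorm :
    entourage = entourage_ (fun (x : A) e => [set y : A | cnorm (x - y) < e]);
  cnorm_complete : forall F : set_system A,
    ProperFilter F -> cauchy F -> exists l : A, F --> l;
  starK : involutive star;
  starD : forall x y : A, star (x + y) = star x + star y;
  starZ : forall (c : R[i]) (x : A), star (c *: x) = c^*%C *: star x;
  starM : forall x y : A, star (x * y) = star y * star x;
  cnorm_star : forall x : A, cnorm (star x * x) = cnorm x ^+ 2
}.

#[short(type="cstarAlgType")]
HB.structure Definition CStarAlgebra (R : realType) :=
  { A of isCStarAlgebra R A & Uniform A & GRing.UnitAlgebra R[i] A }.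

Section CStarAlgebraNotions.
Context {R : realType} {A : cstarAlgType R}.
Implicit Types (L I : set A) (p u x y : A) (phi : {scalar A}).

Definition commutator x y : A := x * y - y * x.

Definition linear_subspace L : Prop := submod_closed [in L].

Definition lie_ideal L : Prop :=
  linear_subspace L /\ forall a x, L x -> L (commutator a x).

Definition unitary u : Prop := star u * u = 1 /\ u * star u = 1.

Definition projection p : Prop := star p = p /\ p * p = p.

Definition two_sided_ideal I : Prop :=
  linear_subspace I /\ forall a x, I x -> I (a * x) /\ I (x * a).

Definition positive_functional phi : Prop := forall a : A, 0 <= phi (star a * a).

Definition functional_norm phi : \bar R :=
  ereal_sup [set (normc (phi a))%:E | a in [set a : A | cnorm a <= 1]].

Definition tracial_state phi : Prop :=
  [/\ positive_functional phi,
      functional_norm phi = 1%E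
    & forall a b : A, phi (a * b) = phi (b * a)].

End CStarAlgebraNotions.

(* Simplicity is the C*-algebraic one, about closed ideals; A is nonzero
   because 1 != 0 in every unitAlgType. *)
Definition simple_cstar (R : realType) (A : cstarAlgType R) : Prop :=
  forall I : set A, two_sided_ideal I -> closed I -> I = [set 0] \/ I = setT.

Definition at_most_one_tracial_state (R : realType) (A : cstarAlgType R) : Prop :=
  forall phi psi : {scalar A}, tracial_state phi -> tracial_state psi ->
    phi =1 psi.

(* Main.v *)
(* Unitarily invariant => Lie ideal: for skew-adjoint [k] and small real [t] the
   Cayley transform [u = (1 + t k) / (1 - t k)] is unitary and
   [u^* x u = x - 2 t [k, x] + O(t^2)], so [[k, x]] is a limit of elements of
   [L]; every element of [A] is a combination of two skew-adjoint ones.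
   Lie ideal => similarity invariant: by Herstein's argument a closed Lie ideal
   [L] of [A] is central or contains every commutator. In both cases
   [s^-1 x s - x], which is the commutator of [s^-1] and [x s], lies in [L]. *)
Require Import Defs.
From mathcomp Require Import all_boot all_order all_algebra.
From mathcomp Require Import complex.
From mathcomp Require Import all_classical all_reals all_analysis.
From mathcomp Require Import ring lra.

Import Order.TTheory GRing.Theory Num.Theory.

Local Open Scope classical_set_scope.
Local Open Scope ring_scope.

Lemma closed_forall {X : topologicalType} {I : Type} (F : I -> set X) :
  (forall i, closed (F i)) -> closed [set x | forall i, F i x].
Proof.
move=> cF; have -> : [set x | forall i, F i x] = \bigcap_i F i.
  by apply/seteqP; split => [x h i _|x h i]; [exact: h|exact: h Logic.I].
by apply: closed_bigI => i _; exact: cF.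
Qed.

(** * Linear subspaces *)

Section LinearSubspaces.
Context {R : realType} {A : cstarAlgType R}.
Context (L : set A) (hL : linear_subspace L).

Lemma subspace0 : L 0.
Proof. by have [h _] := hL; move: h; rewrite in_setE. Qed.

Lemma subspaceDZ (c : R[i]) (x y : A) : L x -> L y -> L (c *: x + y).
Proof.
have [_ h] := hL => Lx Ly.
by have := h c x y; rewrite !in_setE; apply.
Qed.

Lemma subspaceZ (c : R[i]) (x : A) : L x -> L (c *: x).
Proof.
move=> Lx; rewrite -[_ *: _]addr0; apply: subspaceDZ => //.
exact: subspace0.
Qed.

Lemma subspaceD (x y : A) : L x -> L y -> L (x + y).
Proof. by move=> Lx Ly; rewrite -[x]scale1r; exact: subspaceDZ. Qed.

Lemma subspaceN (x : A) : L x -> L (- x).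
Proof. by rewrite -scaleN1r; exact: subspaceZ. Qed.

Lemma subspaceB (x y : A) : L x -> L y -> L (x - y).
Proof. by move=> Lx Ly; apply: subspaceD => //; exact: subspaceN. Qed.

End LinearSubspaces.

Lemma linear_subspaceP {R : realType} {A : cstarAlgType R} (L : set A) :
  L 0 -> (forall (c : R[i]) x y, L x -> L y -> L (c *: x + y)) ->
  linear_subspace L.
Proof.
move=> L0 LDZ; split; first by rewrite in_setE.
by move=> c x y; rewrite !in_setE; exact: LDZ.
Qed.

(** * Norm, involution, and invertibility near the identity *)

Section Norm.
Context {R : realType} {A : cstarAlgType R}.
Implicit Types (x y k u : A) (L : set A).

Lemma cnorm0 : cnorm (0 : A) = 0 :> R.
Proof. by rewrite -(scale0r (0 : A)) cnormZ ComplexField.Normc.normc0 mul0r. Qed.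

Lemma cnormN x : cnorm (- x) = cnorm x.
Proof.
rewrite -scaleN1r cnormZ /ComplexField.Normc.normc /=.
by rewrite oppr0 expr0n addr0 sqrrN expr1n sqrtr1 mul1r.
Qed.

Lemma cnormB x y : cnorm (x - y) <= cnorm x + cnorm y.
Proof. by rewrite -(cnormN y) cnormD. Qed.

Lemma cnorm_ge0 x : 0 <= cnorm x.
Proof. by have := cnormB x x; rewrite subrr cnorm0; lra. Qed.

Lemma cnormZr (t : R) x : 0 <= t -> cnorm (t%:C%C *: x) = t * cnorm x.
Proof.
by move=> t0; rewrite cnormZ /ComplexField.Normc.normc /= expr0n addr0 sqrtr_sqr ger0_norm.
Qed.

Lemma cnorm_small x : (forall e : R, 0 < e -> cnorm x < e) -> x = 0.
Proof.
move=> h; apply: (cnorm0_eq0 x); apply/eqP; rewrite eq_le cnorm_ge0 andbT.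
by rewrite leNgt; apply/negP => /h; rewrite ltxx.
Qed.

Lemma star0 : star (0 : A) = 0.
Proof. by apply: (addrI (star (0 : A))); rewrite -starD !addr0. Qed.

Lemma starN x : star (- x) = - star x.
Proof. by apply/eqP; rewrite -addr_eq0 -starD addNr star0. Qed.

Lemma star1 : star (1 : A) = 1.
Proof. by have := starM (star (1 : A)) 1; rewrite mulr1 starK mulr1 => <-. Qed.

(** The C*-identity at 1 makes the norm of 1 idempotent, and it is nonzero because [1 != 0] in
    [A]. *)
Lemma cnorm1 : cnorm (1 : A) = 1 :> R.
Proof.
have := cnorm_star (1 : A); rewrite star1 mulr1 => /eqP.
rewrite expr2 -subr_eq0 -{1}[cnorm 1]mulr1 -mulrBr mulf_eq0 => /orP[/eqP h|].
  by have /eqP := cnorm0_eq0 (1 : A) h; rewrite oner_eq0.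
by rewrite subr_eq0 => /eqP.
Qed.

Lemma cnormX x n : cnorm (x ^+ n) <= cnorm x ^+ n.
Proof.
elim: n => [|n IHn]; first by rewrite !expr0 cnorm1.
rewrite !exprS; apply: le_trans (cnormM _ _) _.
by rewrite ler_wpM2l // cnorm_ge0.
Qed.

Lemma unitary_unit u : unitary u -> u \is a GRing.unit.
Proof. by move=> [su us]; apply/unitrP; exists (star u). Qed.

Lemma unitaryV u : unitary u -> u^-1 = star u.
Proof.
move=> hu; apply: (mulIr (unitary_unit u hu)).
by rewrite mulVr ?unitary_unit //; have [-> _] := hu.
Qed.

Lemma nbhs_cnormP x (B : set A) :
  nbhs x B <-> exists2 e : R, 0 < e & forall y, cnorm (x - y) < e -> B y.
Proof.
rewrite -nbhs_entourageE /nbhs_ /filter_from /=; split.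
- case=> E; rewrite entourage_cnorm => -[e /= e0 he] hE; exists e => // y xy.
  by apply: hE; apply/mem_set; apply: he.
- case=> e e0 h; exists [set xy : A * A | cnorm (xy.1 - xy.2) < e].
    by rewrite entourage_cnorm; exists e.
  by move=> y; rewrite /xsection /= in_setE /=; exact: h.
Qed.

Lemma closed_cnormP L :
  closed L <-> forall x, (forall e : R, 0 < e ->
    exists2 y, L y & cnorm (x - y) < e) -> L x.
Proof.
split=> [cL x h|h x clx]; last first.
  apply: h => e e0.
  have [|y [Ly xy]] := clx [set y | cnorm (x - y) < e]; last by exists y.
  by apply/nbhs_cnormP; exists e.
apply: cL => B /nbhs_cnormP[e e0 hB].
by have [y Ly xy] := h e e0; exists y; split => //; exact: hB.
Qed.

(* Summing the series is avoided: with [s_n] the partial sums of [k ^+ i],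
   [(1 - k) * (s_m - s_n) = k ^+ n - k ^+ m] already bounds [s_m - s_n]. *)
Lemma unit_sub1 k : cnorm k < 1 -> 1 - k \is a GRing.unit.
Proof.
set q := cnorm k => q1.
have q0 : 0 <= q := cnorm_ge0 k.
pose s n : A := \sum_(i < n) k ^+ i.
have sE n : (1 - k) * s n = 1 - k ^+ n.
  by rewrite -opprB mulNr -subrX1 opprB.
have sC n : s n * (1 - k) = (1 - k) * s n.
  have kC i : GRing.comm k (k ^+ i) by exact: commrX.
  have ksC : GRing.comm k (s n) by apply: commr_sum => i _; exact: kC.
  by rewrite mulrBr mulrBl mulr1 mul1r ksC.
have qn (e : R) : 0 < e -> exists N, forall n, (N <= n)%N -> q ^+ n < e.
  move=> e0; have q1' : `|q| < 1 by rewrite ger0_norm.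
  have /cvgrPdist_lt/(_ e e0)[N _ hN] := cvg_expr q1'.
  by exists N => n /hN /=; rewrite sub0r normrN ger0_norm // exprn_ge0.
have sB m n : cnorm (s m - s n) * (1 - q) <= q ^+ n + q ^+ m.
  (* In this form the difference reappears with a factor [k] of norm [q < 1], so its norm can be
     absorbed on the left. *)
  have dE : s m - s n = k * (s m - s n) + (k ^+ n - k ^+ m).
    apply/eqP; rewrite -subr_eq0 opprD addrA -[X in X - _ - _]mul1r -mulrBl.
    by rewrite mulrBr !sE opprB [X in X - _]addrC addrA subrK subrr.
  have h : cnorm (s m - s n) <= q * cnorm (s m - s n) + (q ^+ n + q ^+ m).
    rewrite {1}dE; apply: le_trans (cnormD _ _) _; apply: lerD; first exact: cnormM.
    by apply: le_trans (cnormB _ _) _; apply: lerD; exact: cnormX.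
  by rewrite mulrBr mulr1 [_ * q]mulrC; lra.
have [|l hl] := cnorm_complete (s @ \oo).
  move=> E; rewrite entourage_cnorm => -[e /= e0 he].
  (* The bound [sB] has two powers of [q] on the right and the factor [1 - q] on the left. *)
  have [|N hN] := qn (e * (1 - q) / 2).
    by rewrite divr_gt0 // mulr_gt0 // subr_gt0.
  pose P := [set y : A | exists2 n, (N <= n)%N & y = s n].
  exists (P, P) => /=.
    by split; exists N => // n /= Nn; exists n.
  move=> [_ _] /= [[m Nm ->] [n Nn ->]]; apply: he => /=.
  rewrite -(ltr_pM2r (x := 1 - q)) ?subr_gt0 //.
  apply: le_lt_trans (sB _ _) _.
  by have := hN _ Nm; have := hN _ Nn; lra.
have hl2 (e : R) : 0 < e -> exists n, cnorm (l - s n) < e /\ q ^+ n < e.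
  move=> e0.
  have [N1 hN1] := qn _ e0.
  have [|N2 _ hN2] := hl [set y | cnorm (l - y) < e].
    by apply/nbhs_cnormP; exists e.
  exists (maxn N1 N2); split; last by apply: hN1; exact: leq_maxl.
  by apply: hN2; rewrite /= leq_maxr.
have n1k : cnorm (1 - k) <= 2.
  by apply: le_trans (cnormB _ _) _; rewrite cnorm1 -/q; lra.
(* On either side the residual is the product of [l - s n] and [1 - k], minus [k ^+ n]; its norm is
   below [2 * (e / 3) + e / 3]. *)
apply/unitrP; exists l; split; apply/eqP; rewrite -subr_eq0; apply/eqP;
  apply: cnorm_small => e e0; have [|n [ln kn]] := hl2 (e / 3);
  rewrite ?divr_gt0 //.
- have -> : l * (1 - k) - 1 = (l - s n) * (1 - k) - k ^+ n.
    by rewrite [in RHS]mulrBl sC sE -[in RHS]addrA -opprD subrK.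
  apply: le_lt_trans (cnormB _ _) _.
  have := cnormM (l - s n) (1 - k).
  have := cnormX k n.
  have := cnorm_ge0 (l - s n).
  rewrite -/q.
  nra.
- have -> : (1 - k) * l - 1 = (1 - k) * (l - s n) - k ^+ n.
    by rewrite [in RHS]mulrBr sE -[in RHS]addrA -opprD subrK.
  apply: le_lt_trans (cnormB _ _) _.
  have := cnormM (1 - k) (l - s n).
  have := cnormX k n.
  have := cnorm_ge0 (l - s n).
  rewrite -/q.
  nra.
Qed.

(** Serves for the maps [y |-> r * y * s] and [x |-> commutator x r], whose Lipschitz constants are
    explicit. *)
Lemma closed_lipschitz_preimage L (f : A -> A) (C : R) :
  (forall x y, cnorm (f x - f y) <= C * cnorm (x - y)) ->
  closed L -> closed (f @^-1` L).
Proof.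
move=> hf /closed_cnormP cL; apply/closed_cnormP => x hx; apply: cL => e e0.
(* The sign of [C] is not assumed, so the divisor is made positive. *)
have C1 : 0 < `|C| + 1 by rewrite ltr_wpDl.
have [y Ly xy] := hx (e / (`|C| + 1)) (divr_gt0 e0 C1).
exists (f y) => //; apply: le_lt_trans (hf x y) _.
move: xy; rewrite ltr_pdivlMr // mulrC; apply: le_lt_trans.
by rewrite ler_wpM2r ?cnorm_ge0 //; have := ler_norm C; lra.
Qed.

End Norm.

(** * Commutator identities and estimates *)

Section Commutator.
Context {R : realType} {A : cstarAlgType R}.
Implicit Types (a x y z k d : A).

Lemma commutatorN x y : - commutator x y = commutator y x.
Proof. by rewrite /commutator opprB. Qed.

Lemma commutator_linearl (c : R[i]) x y z :
  commutator (c *: x + y) z = c *: commutator x z + commutator y z.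
Proof.
rewrite /commutator mulrDl mulrDr scalerBr -scalerAl -scalerAr opprD.
by rewrite addrACA.
Qed.

Lemma commutatorBl x y z : commutator (x - y) z = commutator x z - commutator y z.
Proof. by rewrite addrC -scaleN1r commutator_linearl scaleN1r addrC. Qed.

Lemma commutatorZl (c : R[i]) x y : commutator (c *: x) y = c *: commutator x y.
Proof. by rewrite /commutator scalerBr -scalerAl -scalerAr. Qed.

Lemma commutatorM a x y :
  commutator a (x * y) = commutator a x * y + x * commutator a y.
Proof. by rewrite /commutator mulrBl mulrBr !mulrA addrA subrK. Qed.

(** Unlike the Leibniz rule, this leaves no outer factor: [x] and [y] each stand alone in a first
    slot. Hence the elements whose commutators all lie in a given subspace are closed under
    products. *)
Lemma commutatorMl x y z :
  commutator (x * y) z = commutator x (y * z) + commutator y (z * x).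
Proof. by rewrite /commutator !mulrA addrA subrK. Qed.

Lemma cnorm_commutator x y : cnorm (commutator x y) <= 2 * cnorm x * cnorm y.
Proof.
apply: le_trans (cnormB _ _) _.
by have := cnormM x y; have := cnormM y x; rewrite [cnorm y * _]mulrC; lra.
Qed.

Lemma mul_1D_1B k d : (1 + k) * d * (1 - k) = d + commutator k d - k * d * k.
Proof.
by rewrite mulrBr mulr1 !mulrDl mul1r /commutator opprD !addrA.
Qed.

End Commutator.

(** * From unitary invariance to Lie ideals *)

Section UnitaryInvariance.
Context {R : realType} {A : cstarAlgType R}.
Implicit Types (x k u a : A) (L : set A).

(* [u] is the Cayley transform [(1 + k) / (1 - k)]. *)
Lemma cayley_unitary k : star k = - k -> 1 - k \is a GRing.unit ->
  exists u, [/\ unitary u, (1 + k) * star u = 1 - k & u * (1 - k) = 1 + k].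
Proof.
move=> kk ku; set v := (1 - k)^-1.
have vk : v * (1 - k) = 1 by rewrite mulVr.
have kv : (1 - k) * v = 1 by rewrite mulrV.
have sk : star (1 - k) = 1 + k by rewrite starD starN star1 kk opprK.
have svk : star v * (1 + k) = 1 by rewrite -sk -starM kv star1.
have ksv : (1 + k) * star v = 1 by rewrite -sk -starM vk star1.
have kC : (1 + k) * (1 - k) = (1 - k) * (1 + k).
  by rewrite mulrDl mul1r [RHS]mulrDr mulr1 mulrBr mulrBl mulr1 mul1r.
have vC : (1 + k) * v = v * (1 + k).
  by rewrite -[LHS]mul1r -{1}vk -mulrA [(1 - k) * _]mulrA -kC -mulrA kv mulr1.
have su : star ((1 + k) * v) = star v * (1 - k).
  by rewrite starM -sk starK.
exists ((1 + k) * v); split.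
- split; rewrite su.
    by rewrite vC -mulrA [(1 - k) * _]mulrA kv mul1r.
  by rewrite vC -mulrA [(1 + k) * _]mulrA ksv mul1r.
- by rewrite su mulrA ksv mul1r.
- by rewrite -mulrA vk mulr1.
Qed.

(* With [d = star u * x * u - x], the Cayley relations read
   [(1 + k) * d * (1 - k) = - 2 [k, x]], so [d] is [- 2 [k, x]] up to a term
   quadratic in [k]. *)
Lemma cayley_conj k x : star k = - k -> 4 * cnorm k <= 1 ->
  exists2 u, unitary u &
    cnorm (star u * x * u - x + commutator k x *+ 2) <=
      24 * cnorm k ^+ 2 * cnorm x.
Proof.
move=> kk k4; have k0 := cnorm_ge0 k; have x0 := cnorm_ge0 x.
have [|u [hu ku uk]] := cayley_unitary k kk.
  by apply: unit_sub1; lra.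
exists u => //; set d := _ - x.
have dE : (1 + k) * d * (1 - k) = - commutator k x *+ 2.
  rewrite /d [(1 + k) * _]mulrBr mulrBl (mul_1D_1B k x) !mulrA ku -[_ * u * _]mulrA uk.
  (* The conjugated term has become [(1 - k) * x * (1 + k)]. Its quadratic part [k * x * k] is the
     same as for [k], so it cancels, while the linear parts add up. *)
  have := mul_1D_1B (- k) x; rewrite opprK => ->.
  rewrite !mulNr !mulrN !opprK.
  have -> : commutator (- k) x = - commutator k x.
    by rewrite -scaleN1r commutatorZl scaleN1r.
  move: (commutator k x) => c; rewrite opprB addrA subrK opprD addrA.
  rewrite [x - _ - x]addrAC subrr add0r.
  by rewrite mulr2n.
have d2E : d + commutator k x *+ 2 = k * d * k - commutator k d.
  move: dE; rewrite mul_1D_1B mulNrn => /(canRL (subrK _))/(canRL (addrK _)) h.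
  by rewrite {1}h addrC !addrA subrr add0r.
have hkdk : cnorm (k * d * k) <= cnorm k * cnorm d * cnorm k.
  by apply: le_trans (cnormM _ _) _; rewrite ler_wpM2r // cnormM.
have hkd := cnorm_commutator k d.
have d0 := cnorm_ge0 d.
have kd0 : 0 <= cnorm k * cnorm d by rewrite mulr_ge0.
have kx0 : 0 <= cnorm k * cnorm x by rewrite mulr_ge0.
have kd4 : cnorm k * cnorm d <= 1 / 4 * cnorm d by rewrite ler_wpM2r //; lra.
have kdk4 : cnorm k * cnorm d * cnorm k <= cnorm k * cnorm d * (1 / 4).
  by rewrite ler_wpM2l //; lra.
have hkx := cnorm_commutator k x.
(* The constant is [2] from [commutator k d] plus [1 / 4] from [k * d * k]. *)
have h1 : cnorm (d + commutator k x *+ 2) <= (9 / 4) * cnorm k * cnorm d.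
  rewrite d2E; apply: le_trans (cnormB _ _) _; lra.
(* By [h1] and [kd4], [cnorm d] is at most [9 / 16] of itself plus [4 * cnorm k * cnorm x]; this
   gives [64 / 7], rounded up to [10]. Back in [h1] it yields [45 / 2], below the stated [24]. *)
have h2 : cnorm d <= 10 * cnorm k * cnorm x.
  have e : cnorm d <= cnorm (d + commutator k x *+ 2) + 2 * cnorm (commutator k x).
    rewrite -{1}[d](addrK (commutator k x *+ 2)).
    apply: le_trans (cnormB _ _) _; rewrite lerD2l mulr2n.
    by apply: le_trans (cnormD _ _) _; lra.
  lra.
have kkx0 : 0 <= cnorm k * (cnorm k * cnorm x) by rewrite mulr_ge0.
have : cnorm k * cnorm d <= cnorm k * (10 * cnorm k * cnorm x).
  by rewrite ler_wpM2l.
lra.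
Qed.

Lemma unitary_invariant_skew L k x :
  linear_subspace L -> closed L ->
  (forall u : A, unitary u -> [set star u * x * u | x in L] `<=` L) ->
  star k = - k -> L x -> L (commutator k x).
Proof.
move=> hL /closed_cnormP cL inv kk Lx; apply: cL => e e0.
set K := cnorm k; set X := cnorm x.
have K0 : 0 <= K := cnorm_ge0 k.
have X0 : 0 <= X := cnorm_ge0 x.
(* With [t = e / D], the first summand makes the error [12 * t * K ^+ 2 * X] less than [e], the
   second gives [4 * (t * K) <= 1] as [cayley_conj] requires, and the last keeps [D] positive. *)
pose D := 12 * K ^+ 2 * X + 4 * e * K + 1.
have KX0 : 0 <= K ^+ 2 * X by rewrite mulr_ge0 // exprn_ge0.
have eK0 : 0 <= e * K by rewrite mulr_ge0 // ltW.
have D0 : 0 < D by rewrite /D; lra.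
pose t := e / D.
have t0 : 0 < t by rewrite divr_gt0.
have tD : t * D = e by rewrite /t divfK // gt_eqF.
have tK : cnorm (t%:C%C *: k) = t * K by rewrite cnormZr // ltW.
have [||u hu hux] := cayley_conj (t%:C%C *: k) x.
- by rewrite starZ kk conjc_real scalerN.
- rewrite tK -(ler_pM2r e0) mul1r -[leRHS]tD.
  have -> : 4 * (t * K) * e = t * (4 * e * K) by ring.
  by rewrite ler_wpM2l ?(ltW t0) // /D; lra.
pose w := star u * x * u.
(* The difference quotient of the conjugation by the Cayley transform of [t k]; dividing the
   quadratic error by [2 * t] leaves one of order [t]. *)
exists ((- ((2 * t)^-1)%:C%C) *: (w - x)).
  apply: subspaceZ => //; apply: subspaceB => //.
  by apply: (inv u hu); exists x.
have t20 : 0 < 2 * t by lra.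
have t2 : 0 < (2 * t)^-1 by rewrite invr_gt0.
have -> : commutator k x - (- ((2 * t)^-1)%:C%C) *: (w - x) =
    ((2 * t)^-1)%:C%C *: (w - x + commutator (t%:C%C *: k) x *+ 2).
  rewrite [RHS]scalerDr scaleNr opprK addrC; congr (_ + _).
  rewrite commutatorZl -[(_ *: _) *+ 2]scaler_nat !scalerA -[LHS]scale1r; congr (_ *: _).
  rewrite -(rmorph_nat (real_complex R)) -!rmorphM -?mulrA mulVf ?rmorph1 //.
  by rewrite mulf_neq0 // ?pnatr_eq0 ?gt_eqF.
rewrite cnormZr ?(ltW t2) // mulrC ltr_pdivrMr //.
apply: le_lt_trans hux _; rewrite tK -/X.
have -> : 24 * (t * K) ^+ 2 * X = t * (2 * t * (12 * K ^+ 2 * X)) by ring.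
have -> : e * (2 * t) = t * (2 * t * D) by rewrite -tD; ring.
rewrite ltr_pM2l // ltr_pM2l // /D; lra.
Qed.

Lemma unitary_invariant_lie_ideal L :
  linear_subspace L -> closed L ->
  (forall u : A, unitary u -> [set star u * x * u | x in L] `<=` L) ->
  lie_ideal L.
Proof.
move=> hL cL inv; split=> // a x Lx.
(* Both [a - star a] and ['i *: (a + star a)] are skew-adjoint. *)
have -> : a = 2^-1 *: (a - star a) + (- 'i%C / 2) *: ('i%C *: (a + star a)).
  rewrite scalerA.
  have -> : - 'i%C / 2 * 'i%C = 2^-1 :> R[i].
    by rewrite mulrAC mulNr -expr2 sqr_i opprK mul1r.
  rewrite -scalerDr addrACA addNr addr0 -mulr2n -[a *+ 2]scaler_nat scalerA.
  by rewrite mulVf ?scale1r // pnatr_eq0.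
rewrite commutator_linearl commutatorZl.
apply: subspaceDZ => //; last apply: subspaceZ => //.
  apply: unitary_invariant_skew => //.
  by rewrite starD starN starK opprB addrC.
apply: unitary_invariant_skew => //.
rewrite starZ starD starK [star a + a]addrC -scaleNr.
congr (_ *: _).
by apply/eqP; rewrite eq_complex /= oppr0 !eqxx.
Qed.

End UnitaryInvariance.

(** * Closed Lie ideals of a simple algebra *)

Section Herstein.
Context {R : realType} {A : cstarAlgType R} (hsimple : simple_cstar A).
Implicit Types (a c x y r s : A) (L T : set A).

(** The elements [y] with [A y A] inside [T] form a closed two-sided ideal containing [c], hence all
    of [A]; taking both multipliers equal to 1 puts every [y] in [T]. *)
Lemma simple_closed_subspaceT T c :
  linear_subspace T -> closed T -> c <> 0 -> (forall r s, T (r * c * s)) ->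
  forall x, T x.
Proof.
move=> hT cT c0 hc x.
pose J := [set y | forall r s, T (r * y * s)].
have idJ : two_sided_ideal J.
  split.
    apply: linear_subspaceP => [r s|z y y' Jy Jy' r s].
      by rewrite mulr0 mul0r; exact: subspace0.
    rewrite mulrDr mulrDl -scalerAr -scalerAl.
    by apply: subspaceDZ.
  move=> a y Jy; split=> r s.
    by rewrite mulrA; exact: Jy.
  by rewrite mulrA -mulrA; exact: Jy.
have cJ : closed J.
  apply: closed_forall => r; apply: closed_forall => s.
  apply: (closed_lipschitz_preimage T (fun y => r * y * s) (cnorm r * cnorm s)) => //.
  move=> y z; rewrite -mulrBl -mulrBr.
  apply: le_trans (cnormM _ _) _; rewrite mulrAC.
  by rewrite ler_wpM2r ?cnorm_ge0 // cnormM.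
have Jc : J c := hc.
case: (hsimple J idJ cJ) => JE; move: Jc; rewrite JE // => _.
have : J x by rewrite JE.
by move=> /(_ 1 1); rewrite mul1r mulr1.
Qed.

(** The right annihilator of [c] is a closed subspace containing [A c A]. If [c] were nonzero, it
    would be everything and contain 1, forcing [c = 0]. *)
Lemma simple_semiprime c : (forall r, c * r * c = 0) -> c = 0.
Proof.
move=> hc; apply: contrapT => c0.
have := simple_closed_subspaceT [set x | c * x = 0] c.
move=> /(_ _ _ c0 _ 1) /=; rewrite mulr1 => h; apply: c0; apply: h.
- apply: linear_subspaceP => /= [|z x y cx cy]; first by rewrite mulr0.
  by rewrite mulrDr -scalerAr cx cy scaler0 addr0.
- apply/closed_cnormP => x hx /=; apply: cnorm_small => e e0.
  have C1 : 0 < cnorm c + 1 by have := cnorm_ge0 c; lra.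
  have [y cy xy] := hx _ (divr_gt0 e0 C1).
  rewrite -[c * x]subr0 -cy -mulrBr; apply: le_lt_trans (cnormM _ _) _.
  move: xy; rewrite ltr_pdivlMr // mulrC mulrDl mul1r.
  by have := cnorm_ge0 (x - y); lra.
- by move=> r s; rewrite !mulrA hc mul0r.
Qed.

(* [ad a] is a derivation of square zero: expanding [(ad a)^2 (x y)] gives
   [2 [a,x] [a,y] = 0], and then [y := y x] gives [[a,x] y [a,x] = 0]. *)
Lemma simple_commutator2_eq0 a :
  (forall r, commutator a (commutator a r) = 0) -> forall x, commutator a x = 0.
Proof.
move=> ha x.
have aa y : commutator a x * commutator a y = 0.
  have := ha (x * y).
  rewrite commutatorM.
  have cD u v : commutator a (u + v) = commutator a u + commutator a v.
    by rewrite /commutator mulrDr mulrDl opprD addrACA.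
  rewrite cD !commutatorM !ha mul0r mulr0 add0r addr0 -mulr2n -scaler_nat.
  by move/eqP; rewrite scaler_eq0 pnatr_eq0 /= => /eqP.
apply: simple_semiprime => r.
by have := aa (r * x); rewrite commutatorM mulrDr !mulrA aa mul0r add0r.
Qed.

(* [T = {x | [x, A] `<=` L}] is both a subalgebra and a Lie ideal. If [T]
   contains a nonzero commutator [c], these two properties put [A c A] in [T],
   so [T] is everything; if [T] is commutative, then [[x, [x, r]] = 0] for
   all [x] in [L]. *)
Lemma simple_lie_ideal L : closed L -> lie_ideal L ->
  (forall x y, L x -> commutator x y = 0) \/ (forall x y, L (commutator x y)).
Proof.
move=> cL [hL lieL].
have lieLr a x : L x -> L (commutator x a).
  by move=> Lx; rewrite -commutatorN; apply: subspaceN => //; exact: lieL.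
pose T := [set x | forall r, L (commutator x r)].
have hT : linear_subspace T.
  apply: linear_subspaceP => [r|c x y Tx Ty r].
    by rewrite /commutator mul0r mulr0 subrr; exact: subspace0.
  by rewrite commutator_linearl; exact: subspaceDZ.
have cT : closed T.
  apply: closed_forall => r.
  apply: (closed_lipschitz_preimage L (fun x => commutator x r) (2 * cnorm r)) => //.
  by move=> x y; rewrite -commutatorBl mulrAC; exact: cnorm_commutator.
have TM x y : T x -> T y -> T (x * y).
  move=> Tx Ty r; rewrite commutatorMl; apply: subspaceD => //.
have LT x : L x -> T x by move=> Lx r; exact: lieLr.
have TC x r : T x -> T (commutator x r) by move=> Tx; exact: LT.
have [[x [y [Tx Ty /eqP xy]]]|comT] :=
  pselect (exists x y, [/\ T x, T y & commutator x y != 0]).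
  right; apply: (simple_closed_subspaceT T (commutator x y)) => //.
  (* The Leibniz rule writes the product as a commutator with [x] in [T], minus a product of two
     elements of [T]. *)
  have Tcs s : T (commutator x y * s).
    have -> : commutator x y * s = commutator x (y * s) - y * commutator x s.
      by rewrite commutatorM addrK.
    by apply: (subspaceB T hT); [exact: TC|apply: TM => //; exact: TC].
  move=> r s.
  (* A left factor is moved to the right at the cost of a commutator, which stays in the Lie ideal
     [T]. *)
  have -> : r * commutator x y * s =
      commutator x y * (s * r) - commutator (commutator x y * s) r.
    move: (commutator x y) => c.
    by rewrite /commutator opprB !mulrA addrC subrK.
  by apply: (subspaceB T hT); [exact: Tcs|exact: TC].
left=> x y Lx; apply: simple_commutator2_eq0 => r.
apply: contrapT => /eqP h; apply: comT; exists x, (commutator x r).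
by split=> //; apply: LT => //; exact: lieLr.
Qed.

Lemma simple_lie_ideal_conj L s : closed L -> lie_ideal L ->
  s \is a GRing.unit -> [set s^-1 * x * s | x in L] `<=` L.
Proof.
move=> cL lieL su _ [x Lx <-]; have [hL _] := lieL.
have [cen|comm] := simple_lie_ideal L cL lieL.
  (* Here [x] commutes with [s], so conjugation fixes it. *)
  have /eqP := cen x s Lx; rewrite subr_eq0 => /eqP xs.
  by rewrite -mulrA xs mulrA mulVr // mul1r.
have -> : s^-1 * x * s = commutator s^-1 (x * s) + x.
  by rewrite /commutator -(mulrA x) mulrV // mulr1 mulrA subrK.
exact: subspaceD.
Qed.

End Herstein.

(** * The cycle of implications *)

Theorem proposition2p4 (R : realType) (A : cstarAlgType R)
    (hsimple : simple_cstar A)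
    (htrace : at_most_one_tracial_state A)
    (hproj : exists p : A, [/\ projection p, p <> 0 & p <> 1])
    (L : set A) (hL : linear_subspace L) (hLclosed : closed L) :
  (lie_ideal L <->
     (forall s : A, s \is a GRing.unit -> [set s^-1 * x * s | x in L] `<=` L)) /\
  ((forall s : A, s \is a GRing.unit -> [set s^-1 * x * s | x in L] `<=` L) <->
     (forall u : A, unitary u -> [set star u * x * u | x in L] `<=` L)).
Proof.
have h12 : lie_ideal L ->
    forall s : A, s \is a GRing.unit -> [set s^-1 * x * s | x in L] `<=` L.
  by move=> lieL s; exact: simple_lie_ideal_conj.
have h23 :
    (forall s : A, s \is a GRing.unit -> [set s^-1 * x * s | x in L] `<=` L) ->
    forall u : A, unitary u -> [set star u * x * u | x in L] `<=` L.
  move=> inv u hu; rewrite -(unitaryV u hu); exact: inv (unitary_unit u hu).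
have h31 := unitary_invariant_lie_ideal L hL hLclosed.
by split; split; auto.
Qed.
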